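(* Suppose that the support $\operatorname{spt}\mu$ is compact, and let $P$ be a coupling on $X = X_1\times\dotsb\times X_N$. Then for every $\varepsilon>0$ there exists $\sigma(\varepsilon)>0$ (depending on $P$ and $\varepsilon$, but not on the marginals below) such that the following holds: for all marginals $\rho_j\in C(X_j)$, $j=1,\dotsc,N$, if $\lVert \pi_jP-\rho_j\rVert_{L^\infty(\mu_j)}<\sigma(\varepsilon)$ for every $j=1,\dotsc,N$, then there exists $P'\in\Pi(\rho_1,\dotsc,\rho_N)$ with $\lVert P-P'\rVert_{L^\infty(\mu)}<\varepsilon$.
   Context: Let $N\ge 2$ be an integer and let $(X_1,d_1,\mu_1),\dotsc,(X_N,d_N,\mu_N)$ be metric spaces equipped with (Borel) probability measures. Let $X=X_1\times\dotsb\times X_N$, equipped with the product measure $\mu=\mu_1\otimes\dotsb\otimes\mu_N$ and the distance $d(x,x')=\sum_{j=1}^N d_j(x_j,x_j')$. A function $\rho_j\in C(X_j)$ is called a marginal if $\rho_j\ge 0$ and $\int_{X_j}\rho_j\,d\mu_j=1$. For a function $P$ on $X$, $\pi_jP$ denotes its $j$-th marginal, the function on $X_j$ obtained by integrating $P$ with respect to all the measures $\mu_1,\dotsc,\mu_N$ except $\mu_j$. Given marginals $\rho_1,\dotsc,\rho_N$, set $$\Pi(\rho_1,\dotsc,\rho_N)=\{P\in C(X) : P\ge 0,\ \pi_jP=\rho_j \text{ for all } j=1,\dotsc,N\}.$$ A coupling is an element of $\Pi(\rho_1,\dotsc,\rho_N)$ for some marginals $\rho_1,\dotsc,\rho_N$;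 in particular it is a continuous non-negative function. *)

(* Defs.v *)
From HB Require Import structures.
From mathcomp Require Import all_boot all_order all_algebra.
From mathcomp Require Import all_classical all_reals all_analysis.
From mathcomp Require Import measurable_realfun.

Set Implicit Arguments.
Unset Strict Implicit.
Unset Printing Implicit Defensive.

Import Order.TTheory GRing.Theory Num.Theory.
Import numFieldNormedType.Exports.

Local Open Scope classical_set_scope.
Local Open Scope ring_scope.

(* [measurableType] requires a distinguished point.  This is no restriction for
   spaces that carry a probability measure. *)
#[short(type="pmetricType")]
HB.structure Definition PointedMetric (R : numDomainType) :=
  { M of Pointed M & Metric R M }.

Notation borel T := (g_sigma_algebraType (@open T)).

Definition dprod (R : realType) (N : nat) (X : 'I_N -> pmetricType R) : Type :=
  forall j, X j.

Section product_metric.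
Context (R : realType) (N : nat) (X : 'I_N -> pmetricType R).

Definition dprod_dist (x y : dprod X) : R := \sum_(j < N) mdist (x j) (y j).

Let dprod_distxx x : dprod_dist x x = 0.
Proof. by apply: big1 => j _; rewrite mdistxx. Qed.

Let dprod_dist_positivity x y : dprod_dist x y = 0 -> x = y.
Proof.
move=> xy0; apply: functional_extensionality_dep => j.
apply: (@mdist_positivity R).
by apply: (psumr_eq0P _ xy0) => // i _; exact: mdist_ge0.
Qed.

Let dprod_dist_sym x y : dprod_dist x y = dprod_dist y x.
Proof. by apply: eq_bigr => j _; rewrite metric_sym. Qed.

Let dprod_dist_triangle y x z :
  dprod_dist x z <= dprod_dist x y + dprod_dist y z.
Proof.
by rewrite -big_split; apply: ler_sum => j _; exact: metric_triangle.
Qed.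

HB.instance Definition _ := gen_eqMixin (dprod X).
HB.instance Definition _ := gen_choiceMixin (dprod X).
HB.instance Definition _ := isPointed.Build (dprod X) (fun j => point).
HB.instance Definition _ := @isMetric.Build R (dprod X) dprod_dist
  dprod_distxx dprod_dist_positivity dprod_dist_sym dprod_dist_triangle.

End product_metric.

(* The product sigma-algebra; it may be smaller than the Borel sigma-algebra of
   the product metric when the factors are not separable. *)
Section product_sigma_algebra.
Context (R : realType) (N : nat) (X : 'I_N -> pmetricType R).

Definition dprod_cylinders : set (set (dprod X)) :=
  [set C | exists j, exists2 A : set (borel (X j)),
    measurable A & C = [set x | A (x j)]].

Let dprod_measurableC A : <<s dprod_cylinders >> A ->
  <<s dprod_cylinders >> (~` A).
Proof. by move=> mA; rewrite -setTD; exact: sigma_algebraCD. Qed.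

HB.instance Definition _ := @isMeasurable.Build default_measure_display
  (dprod X) <<s dprod_cylinders >> (@sigma_algebra0 _ setT dprod_cylinders)
  dprod_measurableC (@sigma_algebra_bigcup _ setT dprod_cylinders).

End product_sigma_algebra.

Section iterated_integral.
Context (R : realType) (N : nat) (X : 'I_N -> pmetricType R).
Variable mu : forall j, probability (borel (X j)) R.
Local Open Scope ereal_scope.

(* [dfwith x j t] is [x] with its coordinate [j] replaced by [t : X j], so the
   result does not depend on the coordinates of its argument listed in [s]. *)
Fixpoint iterated_integral (s : seq 'I_N) (F : dprod X -> \bar R) :
    dprod X -> \bar R :=
  if s is j :: s' then
    fun x => \int[mu j]_t iterated_integral s' F (dfwith x j t)
  else F.

Lemma iterated_integral_ge0 s F x : (forall y, 0 <= F y) ->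
  0 <= iterated_integral s F x.
Proof.
move=> F0; elim: s x => [|j s IH] x //=.
by apply: integral_ge0 => t _; exact: IH.
Qed.

Lemma measurable_dprod_proj j :
  measurable_fun setT (fun x : dprod X => x j : borel (X j)).
Proof.
move=> _ A mA; rewrite setTI; apply: sub_sigma_algebra.
by exists j; exists A.
Qed.

Lemma measurable_dprod_fun d (T : measurableType d) (f : T -> dprod X) :
  (forall j, measurable_fun setT (fun t => f t j : borel (X j))) ->
  measurable_fun setT f.
Proof.
move=> mf; apply: (@measurability _ _ _ _ setT f (@dprod_cylinders R N X)) => //.
move=> _ [_ [j [A mA ->]] <-].
exact: (mf j measurableT A mA).
Qed.

Lemma measurable_dfwith j : measurable_fun setT
  (fun z : dprod X * borel (X j) => dfwith z.1 j (z.2 : X j) : dprod X).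
Proof.
apply: measurable_dprod_fun => i.
have [<-|ji] := eqVneq j i.
  rewrite (_ : (fun _ => _) = snd) //.
  by apply/funext => z; rewrite dfwithin.
rewrite (_ : (fun _ => _) = (fun x : dprod X => x i : borel (X i)) \o fst).
  exact: (measurableT_comp (@measurable_dprod_proj i) measurable_fst).
by apply/funext => z /=; rewrite dfwithout.
Qed.

Lemma measurable_dfwithr j (x : dprod X) : measurable_fun setT
  (fun t : borel (X j) => dfwith x j (t : X j) : dprod X).
Proof.
have mpair : measurable_fun setT (fun t : borel (X j) => (x, t)).
  exact: measurable_fun_pair.
exact: (measurableT_comp (@measurable_dfwith j) mpair).
Qed.

Lemma measurable_iterated_integral s (F : dprod X -> \bar R) :
  measurable_fun setT F ->
  (forall y, 0 <= F y) -> measurable_fun setT (iterated_integral s F).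
Proof.
move=> mF F0; elim: s => [|j s IH] //=.
apply: (@measurable_fun_fubini_tonelli_F _ _ _ _ _ (mu j)
  (fun z : dprod X * borel (X j) => iterated_integral s F (dfwith z.1 j (z.2 : X j)))).
- exact: measurableT_comp IH (@measurable_dfwith j).
- by move=> z; exact: iterated_integral_ge0.
Qed.

Lemma iterated_integral_nneseries s (F : (dprod X -> \bar R)^nat) x :
  (forall n, measurable_fun setT (F n)) -> (forall n y, 0 <= F n y) ->
  iterated_integral s (fun y => \sum_(n <oo) F n y) x =
  \sum_(n <oo) iterated_integral s (F n) x.
Proof.
move=> mF F0; elim: s x => [|j s IH] x //=.
rewrite -integral_nneseries //.
- by apply: eq_integral => t _; rewrite IH.
- move=> n; apply: measurableT_comp (@measurable_dfwithr j x).
  exact: measurable_iterated_integral.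
- by move=> n t _; exact: iterated_integral_ge0.
Qed.

Lemma iterated_integral_cst s r x :
  iterated_integral s (cst r%:E) x = r%:E.
Proof.
elim: s x => [|j s IH] x //=.
under eq_integral => t _ do rewrite IH.
by rewrite integral_cst // [X in _ * X](probability_setT (mu j)) mule1.
Qed.

End iterated_integral.

Section product_probability.
Context (R : realType) (N : nat) (X : 'I_N -> pmetricType R).
Variable mu : forall j, probability (borel (X j)) R.
Local Open Scope ereal_scope.

Definition dprod_prob (A : set (dprod X)) : \bar R :=
  iterated_integral mu (enum 'I_N) (fun x => (\1_A x)%:E) point.

Let dprod_prob0 : dprod_prob set0 = 0.
Proof.
rewrite /dprod_prob (_ : (fun _ => _) = cst 0%:E) ?iterated_integral_cst //.
by apply/funext => x; rewrite indic0.
Qed.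

Let dprod_prob_ge0 A : 0 <= dprod_prob A.
Proof. by apply: iterated_integral_ge0 => x; rewrite lee_fin. Qed.

Let dprod_prob_sigma_additive : semi_sigma_additive dprod_prob.
Proof.
move=> F mF tF mUF.
have -> : dprod_prob (\bigcup_n F n) = \sum_(n <oo) dprod_prob (F n).
  rewrite /dprod_prob -iterated_integral_nneseries.
  - congr iterated_integral; apply/funext => x.
    by rewrite (indic_bigcup _ tF).
  - by move=> n; apply/measurable_EFinP; exact: measurable_indic.
  - by move=> n y; rewrite lee_fin.
by apply: is_cvg_ereal_nneg_natsum => n _; exact: dprod_prob_ge0.
Qed.

HB.instance Definition _ := isMeasure.Build _ _ _ dprod_prob
  dprod_prob0 dprod_prob_ge0 dprod_prob_sigma_additive.

Let dprod_prob_setT : dprod_prob setT = 1.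
Proof.
rewrite /dprod_prob (_ : (fun _ => _) = cst 1%:E) ?iterated_integral_cst //.
by apply/funext => x; rewrite indicT.
Qed.

HB.instance Definition _ :=
  Measure_isProbability.Build _ _ _ dprod_prob dprod_prob_setT.

End product_probability.

Section product_probability_box.
Context (R : realType) (N : nat) (X : 'I_N -> pmetricType R).
Variable mu : forall j, probability (borel (X j)) R.
Variable A : forall j, set (borel (X j)).
Arguments A : clear implicits.
Hypothesis mA : forall j, measurable (A j).
Local Open Scope ereal_scope.

Let p j : R := fine (mu j (A j)).

Let pE j : mu j (A j) = (p j)%:E.
Proof. by rewrite fineK // fin_num_measure. Qed.

Let iterated_integral_box s (x : dprod X) : uniq s ->
  iterated_integral mu s (fun y => (\prod_j \1_(A j) (y j : borel (X j)))%:E) x =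
  (\prod_(j <- s) p j * \prod_(j | j \notin s) \1_(A j) (x j : borel (X j)))%R%:E.
Proof.
elim: s x => [|i s IH] x /=; first by rewrite big_nil mul1r.
move=> /andP[si us].
pose c : R := (\prod_(j <- s) p j *
  \prod_(j | j \notin i :: s) \1_(A j) (x j : borel (X j)))%R.
transitivity (\int[mu i]_t (c%:E * (\1_(A i) t)%:E)).
  apply: eq_integral => t _; rewrite IH // -EFinM; congr EFin.
  rewrite /c -mulrA; congr (_ * _)%R.
  rewrite (bigD1 i) //= dfwithin mulrC; congr (_ * _)%R.
  apply: eq_big => [j|j /andP[_ ji]]; first by rewrite inE negb_or andbC.
  by rewrite dfwithout // eq_sym.
have c0 : (0 <= c)%R.
  apply: mulr_ge0; last by apply: prodr_ge0 => j _.
  by apply: prodr_ge0 => j _; exact: fine_ge0.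
rewrite ge0_integralZl_EFin //.
  by rewrite integral_indic // setIT [X in _ * X]pE -EFinM /c big_cons mulrC mulrA.
by apply/measurable_EFinP; exact: measurable_indic.
Qed.

Lemma dprod_prob_box :
  dprod_prob mu [set x | forall j, A j (x j)] = \prod_(j < N) mu j (A j).
Proof.
rewrite /dprod_prob (_ : (fun _ => _) =
  fun y => (\prod_j \1_(A j) (y j : borel (X j)))%:E).
  rewrite iterated_integral_box ?enum_uniq // [X in (_ * X)%R]big1.
    by rewrite mulr1 big_enum /= -prodEFin; apply: eq_bigr => j _; rewrite pE.
  by move=> j; rewrite mem_enum.
apply/funext => y; congr EFin; rewrite indicE.
have [Ay|nAy] := pselect (forall j, A j (y j)).
  rewrite mem_set // big1 // => j _.
  by rewrite indicE mem_set.
rewrite memNset //; have /existsNP[j Aj] := nAy.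
by rewrite (bigD1 j) //= indicE memNset ?mul0r.
Qed.

End product_probability_box.

Section coupling_theory.
Context (R : realType) (N : nat) (X : 'I_N -> pmetricType R).
Variable mu : forall j, probability (borel (X j)) R.

(* The support, characterized as the smallest closed set of full measure.  In a
   separable space it exists and is the set of the points all of whose
   neighborhoods have positive measure; in a non-separable one the latter set
   need not have full measure.  Negligibility is used because a closed set need
   not belong to the product sigma-algebra. *)
Definition is_spt (S : set (dprod X)) :=
  [/\ closed S, (dprod_prob mu).-negligible (~` S) &
    forall C, closed C -> (dprod_prob mu).-negligible (~` C) -> S `<=` C].

Definition marginal (j : 'I_N) (rho : X j -> R) :=
  [/\ continuous rho, forall t, 0 <= rho t &
    (\int[mu j]_t (rho t)%:E = 1)%E].

(* The base point [point] is irrelevant: all its coordinates are overwritten. *)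
Definition proj_marginal (j : 'I_N) (P : dprod X -> R) (t : X j) : \bar R :=
  iterated_integral mu [seq i <- enum 'I_N | i != j] (EFin \o P)
    (dfwith point j t).

Definition couplings (rho : forall j, X j -> R) : set (dprod X -> R) :=
  [set P : dprod X -> R | [/\ continuous P, forall x, 0 <= P x &
    forall j (t : X j), proj_marginal P t = (rho j t)%:E]].

Definition is_coupling (P : dprod X -> R) :=
  exists2 rho : forall j, X j -> R,
    forall j, marginal (rho j) & couplings rho P.

End coupling_theory.

Arguments proj_marginal {R N X} mu j P t.

(* Main.v *)
Require Import Defs.
From mathcomp Require Import all_boot all_order all_algebra.
From mathcomp Require Import all_classical all_reals all_analysis.
From mathcomp Require Import measurable_realfun ess_sup_inf lra.

Set Implicit Arguments.
Unset Strict Implicit.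
Unset Printing Implicit Defensive.

Import Order.TTheory GRing.Theory Num.Theory.
Import numFieldNormedType.Exports.

Local Open Scope classical_set_scope.
Local Open Scope ring_scope.

(* Let [p_j] be the marginals of [P].  On the (compact) support, [P] vanishes where
   some [p_j] does, so by compactness [P * \prod_j max (p_j - d) 0 / p_j] is
   uniformly within [k] of [P] once [d] is small in terms of [k].  Multiply it by
   [1 - k]: the result [Q] has marginals [q_j] at most [max (p_j - d) 0], hence at
   most [rho_j] if [rho_j] is within [d] of [p_j], so the defects
   [r_j = rho_j - q_j] are nonnegative.  By Fubini they have a common integral
   [m], and [P' = Q + (\prod_j r_j) / m ^ (N - 1)] has marginals [rho_j].  The
   factor [1 - k] ensures that [m >= k], while [r_j = O(k)] on the support, so the
   correction is [O(k)].

   [P] and the integrands below need not be measurable for the product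
   sigma-algebra; integrals are handled one variable at a time, and Fubini's
   theorem is proved for continuous functions over compact supports. *)

(** * Continuous functions on one or two factors *)

Lemma continuous_pairr (Y T Z : topologicalType) (f : Y * T -> Z) (y : Y) :
  continuous f -> continuous (fun t => f (y, t)).
Proof.
move=> cf t; apply: (@continuous_comp _ _ _ (fun t => (y, t)) f t _ (cf (y, t))).
by apply: cvg_pair => //=; exact: cvg_cst.
Qed.

Lemma continuous_pairl (Y T Z : topologicalType) (f : Y * T -> Z) (t : T) :
  continuous f -> continuous (fun y => f (y, t)).
Proof.
move=> cf y; apply: (@continuous_comp _ _ _ (fun y => (y, t)) f y _ (cf (y, t))).
by apply: cvg_pair => //=; exact: cvg_cst.
Qed.

Lemma continuous_pair_map (Y T Z : topologicalType) (f : Y -> Z) :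
  continuous f -> continuous (fun z : Y * T => (f z.1, z.2)).
Proof.
move=> cf z; apply: cvg_pair => /=; last exact: cvg_snd.
by apply: (@continuous_comp _ _ _ fst f); [exact: cvg_fst|exact: cf].
Qed.

(** Without separability this set need not have full measure; that property is the hypothesis [muK]
    below and is later derived from [is_spt]. *)
Definition msupport (R : realType) (T : pmetricType R)
    (mu : probability (borel T) R) : set T :=
  [set t | forall U : set T, open U -> U t -> (0 < mu U)%E].

Section one_factor.
Context (R : realType) (T : pmetricType R) (mu : probability (borel T) R).
Local Notation K := (msupport mu).

Lemma open_borel (U : set T) : open U -> measurable (U : set (borel T)).
Proof. exact: sub_sigma_algebra. Qed.

Lemma msupport_closed : closed K.
Proof.
rewrite -[K]setCK; apply: open_closedC.
rewrite openE => t /existsNP[U /not_implyP[oU /not_implyP[Ut muU]]].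
rewrite /interior; apply: filterS (open_nbhs_nbhs (conj oU Ut)) => s Us Ks.
by apply: muU; exact: Ks.
Qed.

Lemma msupport_measurable : measurable (K : set (borel T)).
Proof.
rewrite -[K]setCK; apply: measurableC; apply: open_borel.
exact/closed_openC/msupport_closed.
Qed.

Lemma continuous_measurable (f : T -> R) :
  continuous f -> measurable_fun setT (f : borel T -> R).
Proof.
move=> /continuousP cf; apply: (measurability _ (RGenOpens.measurableE R)).
move=> _ [_ [a [b ->] <-]]; rewrite setTI; apply: open_borel.
exact/cf/interval_open.
Qed.

Lemma continuous_EFin_measurable (f : T -> R) : continuous f ->
  measurable_fun setT (fun t : borel T => (f t)%:E).
Proof. by move=> cf; apply/measurable_EFinP; exact: continuous_measurable. Qed.

(** The open set where [f] exceeds [f t / 2] contains [t], so it has positive measure. *)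
Lemma integral_continuous_gt0 (f : T -> R) (t : T) : continuous f ->
  (forall s, 0 <= f s) -> K t -> 0 < f t ->
  (0 < \int[mu]_s (f s)%:E)%E.
Proof.
move=> cf f0 Kt ft.
pose U : set T := f @^-1` [set` `]f t / 2, +oo[].
have oU : open U by move/continuousP : cf; apply; exact: interval_open.
have Ut : U t.
  rewrite /U /= in_itv /= andbT ltr_pdivrMr //.
  by rewrite ltr_pMr // ltr1n.
have c0 : 0 <= f t / 2 by rewrite divr_ge0 // ltW.
have mU := open_borel oU.
apply: (@lt_le_trans _ _ ((f t / 2)%:E * mu U)%E).
  by rewrite mule_gt0 ?(Kt _ oU Ut) // lte_fin divr_gt0.
rewrite -[U]setIT -integral_indic // -ge0_integralZl_EFin //.
- apply: ge0_le_integral => //.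
  + by move=> s _; rewrite -EFinM lee_fin mulr_ge0.
  + apply/measurable_EFinP; apply: measurable_funM => //.
  + exact: continuous_EFin_measurable.
  + move=> s _; rewrite -EFinM lee_fin indicE.
    have [Us|nUs] := boolP (s \in U); last by rewrite mulr0.
    by rewrite mulr1; move: Us; rewrite inE /U /= in_itv /= andbT => /ltW.
- exact/measurable_EFinP/measurable_indic.
Qed.

(** The set where [f] exceeds [c] is open and null, so it cannot meet the support. This turns
    essential bounds into pointwise ones. *)
Lemma msupport_ae_le (f : T -> R) (c : R) : continuous f ->
  {ae mu, forall t : borel T, f t <= c} -> forall t, K t -> f t <= c.
Proof.
move=> cf [A [mA A0 fA]] t Kt; rewrite leNgt; apply/negP => cft.
pose U : set T := f @^-1` [set` `]c, +oo[].
have oU : open U by move/continuousP : cf; apply; exact: interval_open.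
have Ut : U t by rewrite /U /= in_itv /= andbT.
have := Kt _ oU Ut; rewrite (subset_measure0 (open_borel oU) mA _ A0) ?ltxx //.
move=> s; rewrite /U /= in_itv /= andbT => cs; apply: fA => /=.
by apply/negP; rewrite -ltNge.
Qed.

Hypothesis muK : mu (~` K) = 0%E.

Lemma ae_msupport : {ae mu, forall t : borel T, K t}.
Proof.
exists (~` K); split => //; exact: (measurableC msupport_measurable).
Qed.

Lemma msupport_nonempty : exists t, K t.
Proof.
apply: contrapT => /forallNP K0.
have : mu setT = 0%E.
  by rewrite -muK; congr (mu _); apply/seteqP; split => // t _; exact: K0.
by rewrite probability_setT => /eqP; rewrite onee_eq0.
Qed.

Lemma le_integral_msupport (f g : T -> R) : continuous f -> continuous g ->
  (forall t, 0 <= f t) -> (forall t, 0 <= g t) ->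
  (forall t, K t -> f t <= g t) ->
  (\int[mu]_t (f t)%:E <= \int[mu]_t (g t)%:E)%E.
Proof.
move=> cf cg f0 g0 fg; apply: ae_ge0_le_integral => //.
- by move=> t _; rewrite lee_fin.
- exact: continuous_EFin_measurable.
- by move=> t _; rewrite lee_fin.
- exact: continuous_EFin_measurable.
- have [A [mA A0 KA]] := ae_msupport; exists A; split => // t fgt.
  by apply: KA => /= Kt; apply: fgt => _; rewrite lee_fin; exact: fg.
Qed.

Lemma integral_prob_cst (c : R) : (\int[mu]_t c%:E = c%:E)%E.
Proof.
by rewrite integral_cst // [X in (_ * X)%E](probability_setT mu) mule1.
Qed.

Hypothesis cK : compact K.

(* Compactness enters as the tube lemma: [f y] is uniformly close to [f y0] on
   [K] when [y] is close to [y0]. *)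
Lemma parametric_integral (Y : topologicalType) (f : Y -> T -> R) :
  continuous (fun z : Y * T => f z.1 z.2) -> (forall y t, 0 <= f y t) ->
  exists g : Y -> R, [/\ continuous g, forall y, 0 <= g y &
    forall y, (\int[mu]_t (f y t)%:E = (g y)%:E)%E].
Proof.
move=> cf f0.
have cfy y : continuous (f y) by exact: (continuous_pairr cf).
have tube y e : 0 < e ->
    \forall y' \near y, forall t, K t -> `|f y t - f y' t| < e.
  move=> e0; have /compact_near_coveringP := cK.
  move=> /(_ Y (nbhs y) (fun y' t => `|f y t - f y' t| < e) _); apply => t Kt.
  have e20 : 0 < e / 2 by rewrite divr_gt0.
  have /cvgrPdist_lt /(_ _ e20) := cf (y, t).
  case=> -[U V] /= [Uy Vt] UV.
  exists (V, U) => // -[t' y'] /= [Vt' Uy'].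
  have h1 := UV (y, t') (conj (nbhs_singleton Uy) Vt').
  have h2 := UV (y', t') (conj Uy' Vt').
  rewrite /= in h1 h2.
  rewrite (splitr e) (le_lt_trans _ (ltrD h1 h2)) //.
  by rewrite (distrC (f y t)) ler_distD.
have fin y : (\int[mu]_t (f y t)%:E \is a fin_num)%E.
  have /compact_bounded [M [_ MP]] : compact (f y @` K).
    by apply: continuous_compact => //; exact: continuous_subspaceT.
  (* [compact_bounded] only certifies bounds strictly above [M]; the maximum with [0] makes the
     dominating constant nonnegative. *)
  have M1 : M < Num.max (M + 1) 0 by rewrite lt_max ltrDl ltr01.
  rewrite ge0_fin_numE; last by apply: integral_ge0 => t _; rewrite lee_fin.
  apply: (@le_lt_trans _ _ (\int[mu]_t (Num.max (M + 1) 0)%:E)%E).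
    apply: (le_integral_msupport (g := cst (Num.max (M + 1) 0))) => //.
    - by move=> t; exact: cst_continuous.
    - by move=> t; rewrite /= le_max lexx orbT.
    - move=> t Kt; rewrite (le_trans (ler_norm _)) //.
      by apply: MP M1 _ _; exists t.
  by rewrite integral_prob_cst ltry.
(* One-sided, but symmetric in [y] and [y']: applied both ways it gives continuity. Closeness on [K]
   suffices since [K] has full measure and the total mass is [1]. *)
have h y y' e : 0 < e -> (forall t, K t -> `|f y t - f y' t| < e) ->
  fine (\int[mu]_t (f y t)%:E)%E <= fine (\int[mu]_t (f y' t)%:E)%E + e.
  move=> e0 H; rewrite -lee_fin EFinD !fineK //.
  rewrite -[X in (_ <= _ + X)%E]integral_prob_cst -ge0_integralD //.
  - apply: (le_integral_msupport (g := fun t => f y' t + e)) => //.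
    + by move=> t; apply: cvgD; [exact: cfy|exact: cvg_cst].
    + by move=> t; rewrite addr_ge0 // ltW.
    + move=> t /H/ltW; rewrite ler_norml => /andP[_].
      by rewrite lerBlDr addrC.
  - by move=> t _; rewrite lee_fin.
  - exact: continuous_EFin_measurable.
  - by move=> t _; rewrite lee_fin ltW.
exists (fun y => fine (\int[mu]_t (f y t)%:E)%E); split.
- move=> y; apply/cvgrPdist_le => e e0; near=> y'.
  have H : forall t, K t -> `|f y t - f y' t| < e by near: y'; exact: tube.
  rewrite ler_distlC lerBlDr; apply/andP; split; last first.
    by apply: h => // t /H; rewrite distrC.
  exact: h.
- by move=> y; rewrite fine_ge0 // integral_ge0 // => t _; rewrite lee_fin.
- by move=> y; rewrite fineK.
Unshelve. all: by end_near.
Qed.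

End one_factor.

(** * Fubini's theorem for continuous functions *)

Section fubini_continuous.
Context (R : realType) (T1 T2 : pmetricType R).
Variables (mu1 : probability (borel T1) R) (mu2 : probability (borel T2) R).

(** The first center in [l] whose ball has [z.1] in its interior is substituted for [z.1], with
    default [0]. Indicators of open sets make measurability immediate. *)
Fixpoint net_approx (f : T1 -> T2 -> R) (r : R) (l : seq T1)
    (z : borel T1 * borel T2) : R :=
  if l is d :: l' then
    f d z.2 * \1_(ball d r)^° (z.1 : T1) +
      net_approx f r l' z * \1_(~` (ball d r)^°) (z.1 : T1)
  else 0.

Lemma measurable_net_approx f r l : (forall s, continuous (f s)) ->
  measurable_fun setT (net_approx f r l).
Proof.
move=> cf; elim: l => [|d l IH] //=.
have mB : measurable ((ball d r)^° : set (borel T1)).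
  by apply: open_borel; exact: open_interior.
apply: measurable_funD; apply: measurable_funM => //.
- apply: (measurableT_comp (continuous_measurable (cf d))).
  exact: measurable_snd.
- by apply: (measurableT_comp (measurable_indic mB)); exact: measurable_fst.
- apply: (measurableT_comp (measurable_indic (measurableC mB))).
  exact: measurable_fst.
Qed.

Lemma net_approxE f r l (s : T1) (t : T2) :
  (exists2 d, d \in l & (ball d r)^° s) ->
  exists2 d, ball d r s & net_approx f r l (s, t) = f d t.
Proof.
elim: l => [[d']//|d l IH [d']]; rewrite inE => d'l d's /=.
have [ds|nds] := pselect ((ball d r)^° s).
  exists d; first exact: interior_subset.
  by rewrite !indicE (mem_set ds) (@memNset _ (~` _)) ?mulr1 ?mulr0 ?addr0 //=; apply.
have /IH[e es ->] : exists2 e, e \in l & (ball e r)^° s.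
  by exists d' => //; case/orP : d'l => // /eqP d'd; rewrite d'd in d's.
exists e => //.
by rewrite !indicE (memNset nds) mem_set // mulr0 mulr1 add0r.
Qed.

Lemma compact_net (A : set T1) (r : R) : compact A -> 0 < r ->
  exists l : seq T1, forall s, A s -> exists2 d, d \in l & (ball d r)^° s.
Proof.
rewrite compact_cover => cA r0.
have [|s As|l _ Al] := cA _ A (fun d => (ball d r)^°).
- by move=> *; exact: open_interior.
- by exists s => //; exact: nbhsx_ballx.
- by exists (finmap.enum_fset l) => s /Al [d dl ds]; exists d.
Qed.

(* [f] need not be measurable for the product of the Borel sigma-algebras, but
   over a compact set it is a limit of functions that are piecewise constant in
   the first variable. *)
Lemma measurable_patch_continuous (A : set T1) (f : T1 -> T2 -> R) :
  compact A -> continuous (fun z : T1 * T2 => f z.1 z.2) ->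
  measurable_fun setT
    (fun z : borel T1 * borel T2 => f z.1 z.2 * \1_A (z.1 : T1)).
Proof.
move=> cA cf.
have cf2 s : continuous (f s) by exact: (continuous_pairr cf).
have mA : measurable (A : set (borel T1)).
  rewrite -[A]setCK; apply: measurableC; apply: open_borel; apply: closed_openC.
  by apply: compact_closed => //; exact: metric_hausdorff.
have /choice[l lA] : forall n, exists l : seq T1, forall s, A s ->
    exists2 d, d \in l & (ball d n.+1%:R^-1)^° s.
  by move=> n; apply: compact_net => //; rewrite invr_gt0.
apply: (measurable_fun_cvg (h := fun n z =>
    net_approx f n.+1%:R^-1 (l n) z * \1_A (z.1 : T1))).
  move=> n; apply: measurable_funM; first exact: measurable_net_approx.
  by apply: (measurableT_comp (measurable_indic mA)); exact: measurable_fst.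
move=> [s t] _ /=; rewrite !indicE.
have [As|nAs] := boolP (s \in A); last first.
  rewrite mulr0; under eq_fun do rewrite mulr0.
  exact: cvg_cst.
apply: cvgMl; apply/cvgrPdist_lt => e e0.
have /cvgrPdist_lt /(_ _ e0) := cf (s, t).
case=> -[U V] /= [Us Vt] UV.
have /nbhs_ballP [r /= r0 rU] := Us.
(* Once [n.+1%:R^-1] is below [r], the selected center [d] lies in [U], so continuity at [(s, t)]
   applies to [(d, t)]. *)
near=> n.
have [d ds ->] := net_approxE f t (lA n s (set_mem As)).
apply: (UV (d, t)); split; last exact: nbhs_singleton.
apply: rU; apply: ball_sym; apply: le_ball ds.
by apply: ltW; near: n; exact: near_infty_natSinv_lt (PosNum r0).
Unshelve. all: by end_near.
Qed.

(** Cutting [f] off outside the compact support of [mu1] makes it jointly measurable and changes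
    neither iterated integral, so Tonelli's theorem applies to the cut-off function [h]. *)
Lemma fubini_continuous (f : T1 -> T2 -> R) :
  compact (msupport mu1) -> mu1 (~` msupport mu1) = 0%E ->
  compact (msupport mu2) -> mu2 (~` msupport mu2) = 0%E ->
  continuous (fun z : T1 * T2 => f z.1 z.2) -> (forall s t, 0 <= f s t) ->
  (\int[mu1]_s \int[mu2]_t (f s t)%:E = \int[mu2]_t \int[mu1]_s (f s t)%:E)%E.
Proof.
move=> cK1 muK1 cK2 muK2 cf f0.
pose h (z : borel T1 * borel T2) :=
  (f z.1 z.2 * \1_(msupport mu1) (z.1 : T1))%:E.
have mh : measurable_fun setT h.
  by apply/measurable_EFinP; exact: measurable_patch_continuous.
have h0 z : (0 <= h z)%E by rewrite lee_fin mulr_ge0.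
have [g [cg g0 fg]] := parametric_integral muK2 cK2 cf f0.
have cf1 t : continuous (f ^~ t) by exact: (continuous_pairl cf).
have hE s : msupport mu1 s -> forall t, h (s, t) = (f s t)%:E.
  by move=> Ks t; rewrite /h /= indicE mem_set // mulr1.
transitivity (\int[mu1]_s \int[mu2]_t h (s, t))%E.
  apply: ge0_ae_eq_integral => //.
  - under eq_fun do rewrite fg; exact: continuous_EFin_measurable.
  - exact: (measurable_fun_fubini_tonelli_F h).
  - by move=> s _; apply: integral_ge0 => t _; rewrite lee_fin.
  - by move=> s _; apply: integral_ge0.
  - have [A [mA A0 KA]] := ae_msupport muK1; exists A; split => // s fs.
    apply: KA => /= Ks; apply: fs => _; apply: eq_integral => t _.
    by rewrite hE.
rewrite fubini_tonelli //; apply: eq_integral => t _.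
apply: ge0_ae_eq_integral => //.
- by apply: (measurableT_comp mh); exact: measurable_fun_pair.
- exact: continuous_EFin_measurable.
- by move=> s _; rewrite lee_fin.
- have [A [mA A0 KA]] := ae_msupport muK1; exists A; split => // s fs.
  by apply: KA => /= Ks; apply: fs => _; rewrite hE.
Qed.

End fubini_continuous.

(** * Iterated integrals of continuous functions *)

Section dprod_topology.
Context (R : realType) (N : nat) (X : 'I_N -> pmetricType R).

Lemma le_mdist_dprod (x y : dprod X) j : mdist (x j) (y j) <= mdist x y.
Proof.
rewrite [leRHS](bigD1 j) //= lerDl; apply: sumr_ge0 => i _; exact: mdist_ge0.
Qed.

Lemma mdist_dfwith j (x y : dprod X) (t u : X j) :
  mdist (dfwith x j t : dprod X) (dfwith y j u : dprod X) <=
  mdist x y + mdist t u.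
Proof.
rewrite [leLHS](bigD1 j) //= !dfwithin addrC lerD2r.
rewrite [leRHS](bigD1 j) //= addrC.
apply: (@le_trans _ _ (\sum_(i < N | i != j) mdist (x i) (y i))).
  by apply: ler_sum => i ij; rewrite !dfwithout // eq_sym.
by rewrite lerDl mdist_ge0.
Qed.

Lemma continuous_dprod_proj j : continuous (fun x : dprod X => x j).
Proof.
move=> x A /nbhs_ballP[e e0 eA].
have := nbhsx_ballx x e e0; apply: filterS => y xy; apply: eA; move: xy.
rewrite !ballEmdist /=; apply: le_lt_trans; exact: le_mdist_dprod.
Qed.

Lemma continuous_dfwith j :
  continuous (fun z : dprod X * X j => dfwith z.1 j z.2 : dprod X).
Proof.
move=> [x t] A /nbhs_ballP[e /= e0 eA].
have e20 : 0 < e / 2 by rewrite divr_gt0.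
exists (ball x (e / 2), ball t (e / 2)); first by split; exact: nbhsx_ballx.
move=> [y u] /= [xy tu]; apply: eA; move: xy tu; rewrite !ballEmdist /= => xy tu.
by rewrite (le_lt_trans (mdist_dfwith _ _ _ _)) // (splitr e) ltrD.
Qed.

Lemma continuous_comp_dfwith j (f : dprod X -> R) : continuous f ->
  continuous (fun z : dprod X * X j => f (dfwith z.1 j z.2)).
Proof.
move=> cf z; apply: (@continuous_comp _ _ _
  (fun z : dprod X * X j => dfwith z.1 j z.2 : dprod X) f).
  exact: (@continuous_dfwith j z).
exact: cf.
Qed.

Lemma continuous_comp_dfwithr j (f : dprod X -> R) (x : dprod X) :
  continuous f -> continuous (fun t : X j => f (dfwith x j t)).
Proof.
move=> cf.
exact: (continuous_pairr (y := x) (@continuous_comp_dfwith j f cf)).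
Qed.

Lemma box_sub_ball (x : dprod X) (r : R) : 0 < r ->
  exists2 e, 0 < e & forall y : dprod X,
    (forall j, ball (x j) e (y j)) -> ball x r y.
Proof.
(* With [N.+1] instead of [N], the sum of [N] such distances stays strictly below [r], and [N = 0]
   is covered. *)
move=> r0; exists (r / N.+1%:R); first by rewrite divr_gt0.
move=> y xy; rewrite ballEmdist /=.
apply: (@le_lt_trans _ _ (\sum_(j < N) r / N.+1%:R)).
  by apply: ler_sum => j _; have := xy j; rewrite ballEmdist => /ltW.
rewrite sumr_const card_ord -[ltLHS]mulr_natl mulrCA gtr_pMr //.
by rewrite ltr_pdivrMr // mul1r ltr_nat.
Qed.

Lemma dfwith_id (x : dprod X) j : dfwith x j (x j) = x.
Proof.
apply: functional_extensionality_dep => i.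
by have [<-|ji] := eqVneq j i; rewrite ?dfwithin // dfwithout.
Qed.

Lemma dfwithC (x : dprod X) i j (s : X i) (t : X j) : i != j ->
  dfwith (dfwith x i s) j t = dfwith (dfwith x j t) i s.
Proof.
move=> ij; apply: functional_extensionality_dep => k.
have [<-|ik] := eqVneq i k.
  by rewrite dfwithin dfwithout 1?eq_sym // dfwithin.
rewrite [RHS]dfwithout //.
by have [<-|jk] := eqVneq j k; rewrite ?dfwithin // !dfwithout.
Qed.

End dprod_topology.

Section iterated_integral_continuous.
Context (R : realType) (N : nat) (X : 'I_N -> pmetricType R).
Variable mu : forall j, probability (borel (X j)) R.
Local Notation K j := (msupport (mu j)).
Local Notation I s f := (iterated_integral mu s (EFin \o f)).
Implicit Types (s : seq 'I_N) (f g : dprod X -> R) (x y : dprod X).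

Lemma eq_iterated_integral s (F : dprod X -> \bar R) x y :
  (forall i, i \notin s -> x i = y i) ->
  iterated_integral mu s F x = iterated_integral mu s F y.
Proof.
elim: s x y => [|j s IH] x y xy /=.
  by congr F; apply: functional_extensionality_dep => i; exact: xy.
apply: eq_integral => t _; apply: IH => i si.
have [<-|ji] := eqVneq j i; first by rewrite !dfwithin.
by rewrite !dfwithout // xy // inE negb_or eq_sym ji.
Qed.

Hypothesis cK : forall j, compact (K j).
Hypothesis muK : forall j, mu j (~` K j) = 0%E.

(** [parametric_integral] is applied once per variable. The continuous representative [g] supplies
    finiteness and measurability for every later one-variable integral. *)
Lemma iterated_integral_continuous s f : continuous f -> (forall x, 0 <= f x) ->
  exists g, [/\ continuous g, forall x, 0 <= g x & forall x, I s f x = (g x)%:E].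
Proof.
move=> cf f0; elim: s => [|j s [g [cg g0 fg]]]; first by exists f.
have [h [ch h0 gh]] := parametric_integral (@muK j) (@cK j)
  (@continuous_comp_dfwith _ _ _ j _ cg) (fun x t => g0 (dfwith x j t)).
exists h; split => // x /=.
by rewrite -gh; apply: eq_integral => t _; rewrite fg.
Qed.

(** The integral only sees the slice through [x] whose integrated coordinates lie in the supports,
    so a comparison valid there is enough. *)
Lemma le_iterated_integral s f g x : continuous f -> continuous g ->
  (forall y, 0 <= f y) -> (forall y, 0 <= g y) ->
  (forall y, (forall j, j \in s -> K j (y j)) ->
     (forall j, j \notin s -> y j = x j) -> f y <= g y) ->
  (I s f x <= I s g x)%E.
Proof.
move=> cf cg f0 g0; elim: s x => [|j s IH] x fg /=.
  by rewrite lee_fin; apply: fg.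
have [f' [cf' f'0 ff']] := iterated_integral_continuous s cf f0.
have [g' [cg' g'0 gg']] := iterated_integral_continuous s cg g0.
under eq_integral do rewrite ff'; under [leRHS]eq_integral do rewrite gg'.
apply: (le_integral_msupport (@muK j)
  (f := fun t => f' (dfwith x j t)) (g := fun t => g' (dfwith x j t))).
- exact: continuous_comp_dfwithr.
- exact: continuous_comp_dfwithr.
- by move=> t; exact: f'0.
- by move=> t; exact: g'0.
- move=> t Kt; rewrite -lee_fin -ff' -gg'; apply: IH => y Ky yx.
  apply: fg => i; rewrite inE.
    have [-> _|_ /Ky//] := eqVneq i j.
    by have [/Ky//|/yx ->] := boolP (j \in s); rewrite dfwithin.
  by rewrite negb_or => /andP[ij /yx ->]; rewrite dfwithout // eq_sym.
Qed.

Lemma iterated_integralD s f g x : continuous f -> continuous g ->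
  (forall y, 0 <= f y) -> (forall y, 0 <= g y) ->
  I s (fun y => f y + g y) x = (I s f x + I s g x)%E.
Proof.
move=> cf cg f0 g0; elim: s x => [|j s IH] x //=.
under eq_integral do rewrite IH.
have [f' [cf' f'0 ff']] := iterated_integral_continuous s cf f0.
have [g' [cg' g'0 gg']] := iterated_integral_continuous s cg g0.
apply: ge0_integralD => //.
- by move=> t _; rewrite ff' lee_fin.
- under eq_fun do rewrite ff'.
  by apply: continuous_EFin_measurable; exact: continuous_comp_dfwithr.
- by move=> t _; rewrite gg' lee_fin.
- under eq_fun do rewrite gg'.
  by apply: continuous_EFin_measurable; exact: continuous_comp_dfwithr.
Qed.

Lemma iterated_integral_mul s (a f : dprod X -> R) x :
  continuous f -> (forall y, 0 <= f y) -> (forall y, 0 <= a y) ->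
  (forall i y t, i \in s -> a (dfwith y i t) = a y) ->
  I s (fun y => a y * f y) x = ((a x)%:E * I s f x)%E.
Proof.
move=> cf f0 a0; elim: s x => [|j s IH] x aE /=; first by rewrite EFinM.
have {}IH y : I s (fun y => a y * f y) y = ((a y)%:E * I s f y)%E.
  by apply: IH => i z t si; rewrite aE // inE si orbT.
under eq_integral do rewrite IH aE ?mem_head //.
have [f' [cf' f'0 ff']] := iterated_integral_continuous s cf f0.
apply: ge0_integralZl_EFin => //.
- by move=> t _; rewrite ff' lee_fin.
- under eq_fun do rewrite ff'.
  by apply: continuous_EFin_measurable; exact: continuous_comp_dfwithr.
Qed.

(** The inner integrals over [s] are replaced by their continuous representative, to which the
    two-variable Fubini theorem applies. *)
Lemma iterated_integral_swap i j s f x : continuous f -> (forall y, 0 <= f y) ->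
  I [:: i, j & s] f x = I [:: j, i & s] f x.
Proof.
move=> cf f0; have [->//|ij /=] := eqVneq i j.
have [g [cg g0 fg]] := iterated_integral_continuous s cf f0.
transitivity (\int[mu i]_u \int[mu j]_v (g (dfwith (dfwith x i u) j v))%:E)%E.
  by apply: eq_integral => u _; apply: eq_integral => v _; rewrite fg.
rewrite (fubini_continuous (f := fun u v => g (dfwith (dfwith x i u) j v))) //.
  apply: eq_integral => v _; apply: eq_integral => u _.
  by rewrite dfwithC // fg.
pose h (z : X i * X j) := (dfwith x i z.1 : dprod X, z.2).
have ch : continuous h.
  apply: (continuous_pair_map (f := fun u => dfwith x i u : dprod X)).
  exact: (continuous_pairr (y := x) (@continuous_dfwith _ _ X i)).
move=> z.
apply: (@continuous_comp _ _ _ h (fun z => g (dfwith z.1 j z.2)) z (ch z)).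
exact: continuous_comp_dfwith.
Qed.

(** Adjacent swaps bring any index of the list to the front; induction on [s1] then matches the two
    lists head by head. *)
Lemma iterated_integral_perm s1 s2 f x : continuous f ->
  (forall y, 0 <= f y) -> perm_eq s1 s2 -> I s1 f x = I s2 f x.
Proof.
move=> cf f0.
have toFront j s y : j \in s -> I s f y = I (j :: rem j s) f y.
  elim: s y => // i s IH y; rewrite inE /=.
  have [->//|ij js] := eqVneq i j.
  transitivity (I [:: i, j & rem j s] f y); last exact: iterated_integral_swap.
  by apply: eq_integral => t _; exact: IH.
elim: s1 s2 x => [|i s1 IH] s2 x ps; first by case: s2 ps => // k s /perm_size.
have is2 : i \in s2 by rewrite -(perm_mem ps) mem_head.
rewrite (toFront i s2) //=; apply: eq_integral => t _; apply: IH.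
by rewrite -(perm_cons i) (permPl ps) perm_to_rem.
Qed.

Lemma iterated_integral_prod s (r : forall j, X j -> R) (m : 'I_N -> R) x :
  (forall j, continuous (r j)) -> (forall j t, 0 <= r j t) ->
  (forall j, \int[mu j]_t (r j t)%:E = (m j)%:E)%E -> uniq s ->
  I s (fun y => \prod_j r j (y j)) x =
  (\prod_(j <- s) m j * \prod_(j | j \notin s) r j (x j))%:E.
Proof.
move=> cr r0 rm; elim: s x => [|i s IH] x /=; first by rewrite big_nil mul1r.
move=> /andP[si us].
have m0 j : 0 <= m j.
  by rewrite -lee_fin -rm; apply: integral_ge0 => t _; rewrite lee_fin.
pose c : R := \prod_(j <- s) m j * \prod_(j | j \notin i :: s) r j (x j).
transitivity (\int[mu i]_t (c%:E * (r i t)%:E))%E.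
  apply: eq_integral => t _; rewrite IH // -EFinM; congr EFin.
  rewrite /c -mulrA; congr (_ * _)%R.
  rewrite (bigD1 i) //= dfwithin mulrC; congr (_ * _)%R.
  apply: eq_big => [j|j /andP[_ ji]]; first by rewrite inE negb_or andbC.
  by rewrite dfwithout // eq_sym.
rewrite ge0_integralZl_EFin //.
- by rewrite rm -EFinM /c big_cons mulrC mulrA.
- by move=> t _; rewrite lee_fin.
- exact: continuous_EFin_measurable.
- by rewrite mulr_ge0 //; [apply: prodr_ge0 => j _|apply: prodr_ge0].
Qed.

Lemma iterated_integral_gt0 s f x : continuous f -> (forall y, 0 <= f y) ->
  (forall i, i \in s -> K i (x i)) -> 0 < f x -> (0 < I s f x)%E.
Proof.
move=> cf f0; elim: s => [|j s IH] Kx fx //=.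
have [g [cg g0 fg]] := iterated_integral_continuous s cf f0.
under eq_integral do rewrite fg.
apply: (integral_continuous_gt0 (f := fun t => g (dfwith x j t)) (t := x j)).
- exact: continuous_comp_dfwithr.
- by move=> t; exact: g0.
- by apply: Kx; rewrite mem_head.
(* At [t = x j] the modified point is [x] again, so the induction hypothesis gives positivity
   there. *)
- rewrite -lte_fin -fg dfwith_id; apply: IH => // i si.
  by apply: Kx; rewrite inE si orbT.
Qed.

End iterated_integral_continuous.

(** * The support of the product measure *)

Section support.
Context (R : realType) (N : nat) (X : 'I_N -> pmetricType R).
Variable mu : forall j, probability (borel (X j)) R.
Local Notation K j := (msupport (mu j)).
Local Notation prob := (dprod_prob mu).

Lemma measurable_cylinder j (A : set (borel (X j))) : measurable A ->
  measurable [set x : dprod X | A (x j)].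
Proof.
by move=> mA; rewrite -[X in measurable X]setTI; exact: measurable_dprod_proj.
Qed.

Lemma dprod_prob_cylinder j (A : set (borel (X j))) : measurable A ->
  prob [set x | A (x j)] = mu j A.
Proof.
move=> mA.
(* A cylinder is a box whose other sides are whole spaces. *)
pose B : forall i, set (borel (X i)) := dfwith (fun i => setT) j A.
have mB i : measurable (B i).
  rewrite /B; have [ji|ji] := eqVneq j i; first by subst i; rewrite dfwithin.
  by rewrite dfwithout.
have -> : [set x : dprod X | A (x j)] = [set x | forall i, B i (x i)].
  apply/seteqP; split=> x /= => [Ax i|/(_ j)]; last by rewrite /B dfwithin.
  rewrite /B; have [ji|ji] := eqVneq j i; first by subst i; rewrite dfwithin.
  by rewrite dfwithout.
rewrite dprod_prob_box // (bigD1 j) //= big1 ?mule1.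
  by rewrite /B dfwithin.
by move=> i ij; rewrite /B dfwithout 1?eq_sym // probability_setT.
Qed.

Variable S : set (dprod X).
Hypothesis sptS : is_spt mu S.

(** Otherwise a small open box around [x] misses the closed set [S] and is null, although its
    measure is a product of positive numbers. *)
Lemma box_msupport_spt (x : dprod X) : (forall j, K j (x j)) -> S x.
Proof.
have [cS [B [mB B0 SB]] _] := sptS; move=> Kx; apply: contrapT => nSx.
have /nbhs_ballP[r /= r0 rS] : nbhs x (~` S).
  by apply: open_nbhs_nbhs; split => //; exact: closed_openC.
have [e e0 eS] := box_sub_ball x r0.
pose A j : set (borel (X j)) := (ball (x j) e)^°.
have oA j : open (A j : set (X j)) by exact: open_interior.
have mA j : measurable (A j) by exact: open_borel.
have Apos j : (0 < mu j (A j))%E.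
  by apply: Kx => //; exact: nbhsx_ballx.
pose box : set (dprod X) := [set y | forall j, A j (y j)].
have mbox : measurable box.
  rewrite (_ : box = \bigcap_(j in setT) [set y | A j (y j)]).
    by apply: fin_bigcap_measurable => // j _; exact: measurable_cylinder.
  by apply/seteqP; split=> y /= yA j => [_|]; exact: yA.
have box0 : prob box = 0%E.
  apply: (subset_measure0 mbox mB) B0 => y yA; apply: SB; apply: rS.
  by apply: eS => j; exact: interior_subset (yA j).
have pE j : mu j (A j) = (fine (mu j (A j)))%:E by rewrite fineK // fin_num_measure.
have : (0 < prob box)%E.
  rewrite dprod_prob_box //; under eq_bigr do rewrite pE.
  rewrite prodEFin lte_fin; apply: prodr_gt0 => j _.
  by rewrite -lte_fin -pE.
by rewrite box0 ltxx.
Qed.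

(** By minimality of [S]: if a neighborhood [U] of [x j] were null, removing the open cylinder over
    [U] from [S] would leave a closed set with negligible complement that misses [x]. *)
Lemma spt_sub_msupport (x : dprod X) j : S x -> K j (x j).
Proof.
have [cS nS minS] := sptS; move=> Sx U oU Ux.
rewrite lt_neqAle measure_ge0 andbT; apply/eqP => U0.
have oUj : open [set y : dprod X | U (y j)].
  by move/continuousP : (@continuous_dprod_proj _ _ X j); apply.
have /(_ _ Sx)[_ //] : S `<=` S `&` ~` [set y : dprod X | U (y j)].
apply: minS; first by apply: closedI => //; exact: open_closedC.
rewrite setCI setCK; apply: negligibleU => //.
exists [set y : dprod X | U (y j)]; split => //.
  exact: (measurable_cylinder (open_borel oU)).
by rewrite U0; exact: (dprod_prob_cylinder (open_borel oU)).
Qed.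

(** The cylinder over the complement of [K j] misses [S], hence lies in a null set. *)
Lemma mu_msupportC j : mu j (~` K j) = 0%E.
Proof.
have [_ [B [mB B0 SB]] _] := sptS.
have mK := measurableC (msupport_measurable (mu j)).
rewrite -dprod_prob_cylinder //.
apply: (subset_measure0 (measurable_cylinder mK) mB _ B0) => x /= Kx.
by apply: SB => /(@spt_sub_msupport x j).
Qed.

(** [K j] is the projection of [S]: a point of [K j] is lifted to [S] by filling the other
    coordinates with points [k i] of the supports. *)
Lemma msupport_compact j : compact S -> compact (K j).
Proof.
move=> cS.
have ne i := msupport_nonempty (@mu_msupportC i).
pose k i := sval (cid (ne i)).
have Kk i : K i (k i) by rewrite /k; case: cid.
have -> : K j = (fun x : dprod X => x j) @` S.
  apply/seteqP; split=> [t Kt|_ [x /(@spt_sub_msupport x j) Kx <-]//].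
  exists (dfwith k j t); last by rewrite dfwithin.
  apply: box_msupport_spt => i.
  have [ji|ji] := eqVneq j i; first by subst i; rewrite dfwithin.
  by rewrite dfwithout //; exact: Kk.
apply: continuous_compact => //; apply: continuous_subspaceT.
exact: continuous_dprod_proj.
Qed.

End support.

(** * Truncation and correction of a coupling *)

Lemma Lnorm_pinfty_le d (T : measurableType d) (R : realType)
    (mu : probability T R) (f : T -> \bar R) (r : \bar R) :
  ('N[mu]_+oo[f] <= r)%E <-> {ae mu, forall x, (`|f x| <= r)%E}.
Proof.
(* The norm at [+oo] is an essential supremum only for measures of positive mass; total mass [1]
   selects that branch. *)
rewrite unlock /= probability_setT lte01.
by split => [/ess_supP|?]; [|exact/ess_supP].
Qed.

Lemma continuous_mulr (R : realType) (T : topologicalType) (f g : T -> R) :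
  continuous f -> continuous g -> continuous (fun x => f x * g x).
Proof. by move=> cf cg x; apply: cvgM; [exact: cf|exact: cg]. Qed.

Lemma continuous_addr (R : realType) (T : topologicalType) (f g : T -> R) :
  continuous f -> continuous g -> continuous (fun x => f x + g x).
Proof. by move=> cf cg x; apply: cvgD; [exact: cf|exact: cg]. Qed.

Lemma continuous_prodr (R : realType) (T : topologicalType) (I : Type)
    (s : seq I) (f : I -> T -> R) : (forall i, continuous (f i)) ->
  continuous (fun x => \prod_(i <- s) f i x).
Proof.
move=> cf; elim: s => [|i s IH] x.
  by under eq_fun do rewrite big_nil; exact: cvg_cst.
by under eq_fun do rewrite big_cons; apply: cvgM; [exact: cf|exact: IH].
Qed.

(** The Weierstrass product inequality: the loss of a product is at most the sum of the losses of
    its factors. *)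
Lemma prodr_ge_sub_sum (R : realType) (I : Type) (s : seq I) (u : I -> R) :
  (forall i, 0 <= u i <= 1) ->
  1 - \sum_(i <- s) (1 - u i) <= \prod_(i <- s) u i <= 1.
Proof.
move=> u01; elim: s => [|i s /andP[IH1 IH2]]; first by rewrite !big_nil subr0 lexx.
have /andP[ui0 ui1] := u01 i.
have p0 : 0 <= \prod_(j <- s) u j.
  by apply: prodr_ge0 => j _; have /andP[] := u01 j.
rewrite !big_cons; apply/andP; split; nra.
Qed.

(** * Marginals of continuous functions *)

Section marginals.
Context (R : realType) (N : nat) (X : 'I_N -> pmetricType R).
Variable mu : forall j, probability (borel (X j)) R.
Local Notation K j := (msupport (mu j)).
Local Notation I s f := (iterated_integral mu s (EFin \o f)).
Hypothesis cK : forall j, compact (K j).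
Hypothesis muK : forall j, mu j (~` K j) = 0%E.
Local Notation others j := [seq i <- enum 'I_N | i != j].

Lemma mem_others i j : (i \in others j) = (i != j).
Proof. by rewrite mem_filter mem_enum andbT. Qed.

Lemma perm_others j : perm_eq (j :: others j) (enum 'I_N).
Proof.
rewrite -(rem_filter _ (enum_uniq _)) perm_sym; apply: perm_to_rem.
by rewrite mem_enum.
Qed.

Lemma proj_marginal_continuous (f : dprod X -> R) : continuous f ->
  (forall x, 0 <= f x) ->
  exists q : forall j, X j -> R, [/\ forall j, continuous (q j),
    forall j t, 0 <= q j t & forall j t, proj_marginal mu j f t = (q j t)%:E].
Proof.
move=> cf f0.
have G j := cid (iterated_integral_continuous cK muK (others j) cf f0).
exists (fun j t => sval (G j) (dfwith point j t)); split=> j.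
- by case: (G j) => g [cg g0 fg] /=; exact: continuous_comp_dfwithr.
- by move=> t; case: (G j) => g [cg g0 fg] /=.
- by move=> t; rewrite /proj_marginal; case: (G j) => g [cg g0 fg] /=.
Qed.

(** The outer integral over [X j] completes [others j] to a permutation of all indices. The
    right-hand side does not depend on [j], so all marginals of [f] have the same integral. *)
Lemma integral_proj_marginal (f : dprod X -> R) j : continuous f ->
  (forall x, 0 <= f x) ->
  (\int[mu j]_t proj_marginal mu j f t = I (enum 'I_N) f point)%E.
Proof.
move=> cf f0.
by rewrite -(iterated_integral_perm cK muK point cf f0 (perm_others j)).
Qed.

Lemma le_proj_marginal (f g : dprod X -> R) j t :
  continuous f -> continuous g ->
  (forall y, 0 <= f y) -> (forall y, 0 <= g y) ->
  (forall y, (forall i, i != j -> K i (y i)) -> y j = t -> f y <= g y) ->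
  (proj_marginal mu j f t <= proj_marginal mu j g t)%E.
Proof.
move=> cf cg f0 g0 fg; apply: le_iterated_integral => // y Ky yt; apply: fg.
  by move=> i ij; apply: Ky; rewrite mem_others.
by rewrite yt ?mem_others ?eqxx // dfwithin.
Qed.

Lemma proj_marginal_mul (g : dprod X -> R) j (b : X j -> R) t :
  continuous g -> (forall y, 0 <= g y) -> (forall t, 0 <= b t) ->
  proj_marginal mu j (fun y => b (y j) * g y) t =
  ((b t)%:E * proj_marginal mu j g t)%E.
Proof.
move=> cg g0 b0; rewrite /proj_marginal.
rewrite (iterated_integral_mul cK muK (a := fun y => b (y j)) _ cg g0) //.
  by rewrite dfwithin.
by move=> i y u; rewrite mem_others => ij; rewrite dfwithout.
Qed.

Lemma proj_marginal_prod (r : forall j, X j -> R) (m : R) j t :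
  (forall j, continuous (r j)) -> (forall j t, 0 <= r j t) ->
  (forall j, \int[mu j]_t (r j t)%:E = m%:E)%E ->
  proj_marginal mu j (fun y => \prod_i r i (y i)) t = (m ^+ N.-1 * r j t)%:E.
Proof.
move=> cr r0 rm; rewrite /proj_marginal.
rewrite (iterated_integral_prod (m := fun=> m)) //; last first.
  by rewrite filter_uniq // enum_uniq.
have szo : size (others j) = N.-1.
  by have /perm_size/= := perm_others j; rewrite size_enum_ord => /(congr1 predn).
rewrite big_const_seq count_predT szo iter_mulr_1.
rewrite (big_pred1 j) ?dfwithin //.
by move=> i /=; rewrite mem_others negbK.
Qed.

Lemma coupling_pos (f : dprod X -> R) j (x : dprod X) :
  continuous f -> (forall y, 0 <= f y) -> (forall i, K i (x i)) -> 0 < f x ->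
  (0 < proj_marginal mu j f (x j))%E.
Proof.
move=> cf f0 Kx fx.
(* The base point may be replaced by [x], which agrees with it at [j], the only coordinate not
   integrated. *)
rewrite /proj_marginal (@eq_iterated_integral _ _ _ _ _ _ _ x).
  exact: iterated_integral_gt0.
move=> i; rewrite mem_others negbK => /eqP ->.
by rewrite dfwithin.
Qed.

End marginals.

(* This is [max (p - d) 0 / p], with a denominator that keeps it continuous at
   [p = 0]. *)
Definition trunc (R : realType) (d p : R) : R := Num.max (p - d) 0 / Num.max p d.

Section truncation.
Context (R : realType).
Implicit Types d p : R.

Lemma trunc_bounds d p : 0 < d -> 0 <= p -> 0 <= trunc d p <= 1.
Proof.
move=> d0 p0; rewrite /trunc.
have m0 : 0 < Num.max p d by rewrite lt_max d0 orbT.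
rewrite divr_ge0 ?le_max ?lexx ?orbT ?p0 //=.
rewrite ler_pdivrMr // mul1r ge_max !le_max p0 andbT.
by rewrite lerBlDr lerDl (ltW d0).
Qed.

(** In this range [trunc d p] is [1 - d / p], which increases with [p]. *)
Lemma trunc_ge d p c : 0 < d -> 0 < c -> d <= c -> c <= p -> 1 - d / c <= trunc d p.
Proof.
move=> d0 c0 dc cp; have p0 := lt_le_trans c0 cp; have dp := le_trans dc cp.
rewrite /trunc (max_idPl _) ?subr_ge0 // (max_idPl _) //.
rewrite mulrBl divff ?gt_eqF // lerD2l lerN2 ler_pM2l //.
by rewrite lef_pV2.
Qed.

End truncation.

(** Where [f] is below [e] the bound is trivial. Elsewhere [f] is positive, so all [p j] are locally
    bounded away from [0] and every factor is near [1] for small [d]. Compactness makes [d]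
    uniform. *)
Lemma compact_trunc_close (R : realType) (T : topologicalType) (n : nat)
    (A : set T) (f : T -> R) (p : 'I_n -> T -> R) (e : R) :
  compact A -> continuous f -> (forall x, 0 <= f x) ->
  (forall j, continuous (p j)) -> (forall j x, 0 <= p j x) ->
  (forall x, A x -> 0 < f x -> forall j, 0 < p j x) -> 0 < e ->
  exists2 d, 0 < d &
    forall x, A x -> f x - f x * \prod_j trunc d (p j x) <= e.
Proof.
move=> cA cf f0 cp p0 fp e0.
(* The premise [0 < d] is built in because the sets of values of [d] used below, such as [setT],
   also contain nonpositive numbers. *)
pose close d x := 0 < d -> f x - f x * \prod_j trunc d (p j x) <= e.
suff close_near : \forall d \near 0^'+, A `<=` close d.
  near (0 : R)^'+ => d.
  have d0 : 0 < d by near: d; exact: nbhs_right_gt.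
  exists d => // x Ax; have Ad : A `<=` close d by near: d.
  exact: Ad Ax d0.
move/compact_near_coveringP : cA; apply => x Ax.
have [fxe|efx] := ltP (f x) e.
  exists ([set y | f y < e], setT); last first.
    move=> [y d] /= [fye _] d0; apply: le_trans (ltW fye).
    rewrite lerBlDr lerDl mulr_ge0 // prodr_ge0 // => j _.
    by have /andP[] := trunc_bounds d0 (p0 j y).
  split => /=; last exact: filterT.
  exact: (cvgr_lt _ (cf x) _ fxe).
have fx0 := lt_le_trans e0 efx.
pose c j := p j x / 2.
have c0 j : 0 < c j by rewrite divr_gt0 // fp.
pose B := f x + 1; have B0 : 0 < B by rewrite addr_gt0.
(* If each of the [n] factors loses at most [l], then [f], locally below [B], loses at most
   [B * (n%:R * l) <= e]; [n.+1] avoids a zero denominator. *)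
pose l := e / (B * n.+1%:R); have l0 : 0 < l by rewrite divr_gt0 // mulr_gt0.
exists ([set y | f y < B /\ forall j, c j < p j y],
        [set d | forall j, d < c j /\ d < l * c j]); last first.
  move=> [y d] /= [[fyB cpy] dc] d0.
  have lb j : 1 - l <= trunc d (p j y).
    have [dcj dlc] := dc j.
    apply: le_trans (trunc_ge d0 (c0 j) (ltW dcj) (ltW (cpy j))).
    by rewrite lerD2l lerN2 ler_pdivrMr // ltW.
  have /andP[prod_ge _] := prodr_ge_sub_sum (index_enum 'I_n)
    (fun j => trunc_bounds d0 (p0 j y)).
  have sum_le : \sum_(j < n) (1 - trunc d (p j y)) <= n%:R * l.
    rewrite mulr_natl -[X in _ *+ X](card_ord n) -sumr_const ler_sum // => j _.
    by rewrite lerBlDr -lerBlDl.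
  have nl : B * (n%:R * l) <= e.
    rewrite /l !mulrA ler_pdivrMr ?mulr_gt0 // mulrC.
    by rewrite ler_pM2l // ler_pM2l // ler_nat.
  have nl0 : 0 <= n%:R * l by rewrite mulr_ge0 // ltW.
  rewrite -[X in X - _]mulr1 -mulrBr; apply: le_trans nl.
  apply: (@le_trans _ _ (f y * (n%:R * l))).
    apply: ler_wpM2l => //; rewrite lerBlDl -lerBlDr.
    by apply: le_trans prod_ge; rewrite lerD2l lerN2.
  by apply: ler_wpM2r => //; exact: ltW.
split => /=.
  apply: filterI.
    by apply: (cvgr_lt _ (cf x)); rewrite ltrDl.
  apply: filter_forall => j; apply: (cvgr_gt _ (cp j x)).
  by rewrite /c ltr_pdivrMr // ltr_pMr ?fp // ltr1n.
have small j : \forall d \near (0 : R)^'+, d < c j /\ d < l * c j.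
  near=> r; split; near: r; apply: nbhs_right_lt => //; exact: mulr_gt0.
exact: filter_forall small.
Unshelve. all: by end_near.
Qed.

(** * Construction of the corrected coupling *)

Section perturbation.
Context (R : realType) (N : nat) (X : 'I_N -> pmetricType R).
Variable mu : forall j, probability (borel (X j)) R.
Local Notation K j := (msupport (mu j)).
Hypothesis N0 : (0 < N)%N.
Hypothesis cK : forall j, compact (K j).
Hypothesis muK : forall j, mu j (~` K j) = 0%E.

Variables (P : dprod X -> R) (p rho : forall j, X j -> R).
Arguments p : clear implicits.
Arguments rho : clear implicits.
Hypothesis pP : forall j, marginal mu (p j).
Hypothesis Pp : couplings mu p P.

Variables (k d M : R).
Hypotheses (k0 : 0 < k) (k1 : k < 1) (d0 : 0 < d) (M0 : 0 <= M).
Hypothesis PM : forall x, (forall j, K j (x j)) -> P x <= M.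
Hypothesis Pd : forall x, (forall j, K j (x j)) ->
  P x - P x * \prod_j trunc d (p j (x j)) <= k.

Hypothesis mrho : forall j, marginal mu (rho j).
Hypothesis close : forall j t, K j t -> `|p j t - rho j t| <= Num.min d k.

Let cP : continuous P. Proof. by have [] := Pp. Qed.
Let P0 x : 0 <= P x. Proof. by have [] := Pp. Qed.
Let cp j : continuous (p j). Proof. by have [] := pP j. Qed.
Let p0 j t : 0 <= p j t. Proof. by have [] := pP j. Qed.
Let crho j : continuous (rho j). Proof. by have [] := mrho j. Qed.
Let rho0 j t : 0 <= rho j t. Proof. by have [] := mrho j. Qed.

(* The cap by [rho j] is active only outside the support of [mu j], where nothing
   is known about [rho j]. *)
Let th j t : R := Num.min (Num.max (p j t - d) 0) (rho j t) / Num.max (p j t) d.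
Arguments th : clear implicits.

Let max_gt0 j t : 0 < Num.max (p j t) d.
Proof. by rewrite lt_max d0 orbT. Qed.

Let thE j t : K j t -> th j t = trunc d (p j t).
Proof.
move=> Kt; rewrite /th /trunc (min_idPl _) // ge_max rho0 andbT.
have := close Kt; rewrite ler_norml le_min => /andP[_].
by move/andP => [+ _]; rewrite lerBlDr addrC -lerBlDr.
Qed.

Let th_bounds j t : 0 <= th j t <= 1.
Proof.
have /andP[_ t1] := trunc_bounds d0 (p0 t).
rewrite /th divr_ge0 ?le_min ?le_max ?lexx ?orbT ?rho0 ?p0 //=.
by apply: le_trans t1; rewrite ler_pM2r ?invr_gt0 // ge_min lexx.
Qed.

(** From the cap by [rho j] and the ratio of [p j t] to [Num.max (p j t) d] being at most [1]. It
    holds off the support too, where the defects must also be nonnegative. *)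
Let th_mul_le j t : th j t * p j t <= rho j t.
Proof.
rewrite /th mulrAC ler_pdivrMr //.
apply: ler_pM => //; rewrite ?le_min ?le_max ?lexx ?orbT ?rho0 //.
by rewrite ge_min lexx orbT.
Qed.

Let th_continuous j : continuous (th j).
Proof.
move=> t; apply: cvgM.
  apply: (@continuous_min R (X j) (fun t => Num.max (p j t - d) 0) (rho j) t).
    apply: (@continuous_max R (X j) (fun t => p j t - d) (fun=> 0) t).
      by apply: cvgB; [exact: cp|exact: cvg_cst].
    exact: cvg_cst.
  exact: crho.
apply: cvgV; first by rewrite gt_eqF.
apply: (@continuous_max R (X j) (p j) (fun=> d) t); first exact: cp.
exact: cvg_cst.
Qed.

Let Q (x : dprod X) : R := (1 - k) * (P x * \prod_j th j (x j)).

Let k1' : 0 <= 1 - k. Proof. by rewrite subr_ge0 ltW. Qed.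

Let th_proj_continuous j : continuous (fun x : dprod X => th j (x j)).
Proof.
move=> x; apply: (@continuous_comp _ _ _ (fun x : dprod X => x j) (th j)).
  exact: continuous_dprod_proj.
exact: th_continuous.
Qed.

Let prod_th_bounds (x : dprod X) : 0 <= \prod_j th j (x j) <= 1.
Proof.
apply/andP; split; first by apply: prodr_ge0 => j _; have /andP[] := th_bounds (x j).
by have /andP[] := prodr_ge_sub_sum (index_enum 'I_N)
  (fun j => th_bounds (x j)).
Qed.

Let cQ : continuous Q.
Proof.
have cT := continuous_prodr (s := index_enum 'I_N) th_proj_continuous.
exact: continuous_mulr (@cst_continuous _ _ (1 - k)) (continuous_mulr cP cT).
Qed.

Let Q0 x : 0 <= Q x.
Proof. by have /andP[? _] := prod_th_bounds x; rewrite !mulr_ge0. Qed.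

Let Q_le x : Q x <= P x.
Proof.
have /andP[h0 h1] := prod_th_bounds x; have := P0 x; rewrite /Q => Px.
by rewrite -[leRHS]mul1r ler_pM ?mulr_ge0 // ?gerBl ?(ltW k0) // ler_piMr.
Qed.

(** The truncation costs at most [k], and the factor [1 - k] at most [k * M]. *)
Let P_sub_Q x : (forall j, K j (x j)) -> P x - Q x <= k * (1 + M).
Proof.
move=> Kx; have := Pd Kx; have := PM Kx; have /andP[h0 h1] := prod_th_bounds x.
under eq_bigr do rewrite -thE //.
move: h0 h1 (P0 x); rewrite /Q; set T := \prod_j _ => h0 h1 Px PxM PT.
have : P x * T <= M by rewrite (le_trans _ PxM) // ler_piMr.
by move=> TM; have := ler_wpM2l (ltW k0) TM; lra.
Qed.

(** Keeping only the [j]-th factor leaves [P] times a function of [x j], whose [j]-th marginal is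
    explicit. *)
Let Q_le_slice j (x : dprod X) : Q x <= (1 - k) * th j (x j) * P x.
Proof.
rewrite /Q -mulrA; apply: ler_wpM2l => //; rewrite mulrC.
apply: ler_wpM2r => //.
have /andP[t0 _] := th_bounds (x j); rewrite (bigD1 j) //= ler_piMr //.
by apply: prodr_ile1 => i _; exact: (th_bounds (x i)).
Qed.

(** In the error bound, [k * (1 + M)] accounts for the loss [P - Q] and [k * (2 + M) ^+ N] for the
    added product of defects. *)
Lemma exists_close_coupling : exists2 P', couplings mu rho P' &
  forall x : dprod X, (forall j, K j (x j)) ->
    `|P x - P' x| <= k * (1 + M + (2 + M) ^+ N).
Proof.
have [q [cq q0 Qq]] := proj_marginal_continuous cK muK cQ Q0.
have PpE j t : proj_marginal mu j P t = (p j t)%:E by have [_ _ ->] := Pp.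
have q_le j t : q j t <= (1 - k) * th j t * p j t.
  have b0 u : 0 <= (1 - k) * th j u.
    by rewrite mulr_ge0 //; have /andP[] := th_bounds u.
  have cb : continuous (fun x : dprod X => (1 - k) * th j (x j)).
    exact: continuous_mulr (@cst_continuous _ _ (1 - k)) (@th_proj_continuous j).
  rewrite -lee_fin EFinM -Qq -PpE.
  rewrite -(proj_marginal_mul cK muK (b := fun u => (1 - k) * th j u)) //.
  apply: le_proj_marginal => //; first exact: continuous_mulr.
  by move=> y; rewrite mulr_ge0.
have q_le_rho j t : q j t <= rho j t.
  apply: le_trans (q_le j t) _; apply: le_trans (th_mul_le t).
  rewrite -mulrA ler_piMl ?gerBl ?(ltW k0) //.
  by rewrite mulr_ge0 //; have /andP[] := th_bounds t.
have q_le_p j t : q j t <= (1 - k) * p j t.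
  apply: le_trans (q_le j t) _; apply: ler_wpM2r => //.
  by rewrite ler_piMr //; have /andP[] := th_bounds t.
pose r j t := rho j t - q j t.
have cr j : continuous (r j).
  by move=> t; apply: cvgB; [exact: crho|exact: cq].
have r0 j t : 0 <= r j t by rewrite subr_ge0.
(* Here [k * (1 + M)] comes from integrating [P - Q] over a slice, and one more [k] from the
   distance between [rho j] and [p j]. *)
have r_le j t : K j t -> r j t <= k * (2 + M).
  move=> Kt; have p_le : p j t <= q j t + k * (1 + M).
    have kM0 : 0 <= k * (1 + M) by rewrite mulr_ge0 ?addr_ge0 // ltW.
    rewrite -lee_fin EFinD -Qq -PpE.
    rewrite -[X in (_ <= _ + X)%E](iterated_integral_cst mu
      [seq i <- enum 'I_N | i != j] (k * (1 + M)) (dfwith point j t)).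
    rewrite -(iterated_integralD cK muK _ (g := cst (k * (1 + M)))) //;
      last exact: cst_continuous.
    apply: (@le_proj_marginal _ _ _ _ cK muK _ (fun y => Q y + k * (1 + M))) => //.
    - exact: continuous_addr cQ (@cst_continuous _ _ (k * (1 + M))).
    - by move=> y; rewrite addr_ge0.
    - move=> y Ky yt; rewrite -lerBlDl; apply: P_sub_Q => i.
      by have [ij|/Ky//] := eqVneq i j; subst i; rewrite yt.
  have := close Kt; rewrite ler_norml le_min => /andP[pr _].
  have : - k <= p j t - rho j t.
    by apply: le_trans pr; rewrite lerN2 ge_min lexx orbT.
  rewrite /r; lra.
have [m1 Qm1] : exists m1, iterated_integral mu (enum 'I_N) (EFin \o Q) point = m1%:E.
  have [g [_ _ ->]] := iterated_integral_continuous cK muK (enum 'I_N) cQ Q0.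
  by exists (g point).
have int_q j : (\int[mu j]_t (q j t)%:E = m1%:E)%E.
  rewrite -Qm1 -(integral_proj_marginal cK muK j cQ Q0).
  by apply: eq_integral => t _; rewrite Qq.
have int_p j : (\int[mu j]_t (p j t)%:E = 1)%E by have [] := pP j.
have int_rho j : (\int[mu j]_t (rho j t)%:E = 1)%E by have [] := mrho j.
(* All [q j] share the integral [m1], so integrating [q_le_p] for a single index suffices; [N0]
   provides one. *)
have k_le_m : k <= 1 - m1.
  have : (m1%:E <= (1 - k)%:E)%E.
    rewrite -(int_q (Ordinal N0)) -[leRHS]mule1 -(int_p (Ordinal N0)).
    rewrite -ge0_integralZl_EFin //; last 2 first.
    - by move=> t _; rewrite lee_fin.
    - exact: continuous_EFin_measurable.
    apply: ge0_le_integral => //.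
    - by move=> t _; rewrite lee_fin.
    - exact: continuous_EFin_measurable.
    - apply/measurable_EFinP; apply: measurable_funM => //.
      exact: continuous_measurable.
    - by move=> t _; rewrite -EFinM lee_fin.
  rewrite lee_fin; lra.
pose m := 1 - m1.
have m0 : 0 < m by exact: lt_le_trans k_le_m.
have int_r j : (\int[mu j]_t (r j t)%:E = m%:E)%E.
  have : (\int[mu j]_t (r j t)%:E + m1%:E = 1)%E.
    rewrite -(int_q j) -(int_rho j) -ge0_integralD //.
    - by apply: eq_integral => t _; rewrite -EFinD subrK.
    - by move=> t _; rewrite lee_fin.
    - exact: continuous_EFin_measurable.
    - by move=> t _; rewrite lee_fin.
    - exact: continuous_EFin_measurable.
  by move=> /(congr1 (fun z => z - m1%:E)%E); rewrite addeK // => ->.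
(* The [j]-th marginal of the product of the defects is [m ^+ N.-1 * r j t], so this factor makes
   the correction contribute exactly [r j]. *)
pose c := (m ^+ N.-1)^-1.
have c0 : 0 <= c by rewrite invr_ge0 exprn_ge0 // ltW.
pose S (x : dprod X) : R := \prod_j r j (x j).
have S0 x : 0 <= S x by apply: prodr_ge0.
have cS : continuous S.
  apply: continuous_prodr => j x.
  apply: (@continuous_comp _ _ _ (fun x : dprod X => x j) (r j)).
    exact: continuous_dprod_proj.
  exact: cr.
have ccS : continuous (fun x => c * S x).
  exact: continuous_mulr (@cst_continuous _ _ c) cS.
have cS0 x : 0 <= c * S x by rewrite mulr_ge0.
exists (fun x => Q x + c * S x).
  split; first exact: continuous_addr.
    by move=> x; rewrite addr_ge0.
  move=> j t; rewrite /proj_marginal (iterated_integralD cK muK) //.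
  rewrite -/(proj_marginal mu j Q t) Qq.
  rewrite -/(proj_marginal mu j (fun x => c * S x) t).
  rewrite (proj_marginal_mul cK muK (b := fun=> c)) //.
  rewrite (proj_marginal_prod (m := m)) // -EFinM -EFinD mulrA mulVf.
    by rewrite mul1r addrC subrK.
  by rewrite expf_neq0 // gt_eqF.
move=> x Kx.
have S_le : c * S x <= k * (2 + M) ^+ N.
  (* Split this way, the two factors are compared separately, by [k <= m] and by [r_le]. *)
  have -> : k * (2 + M) ^+ N = (k ^+ N.-1)^-1 * (k * (2 + M)) ^+ N.
    rewrite exprMn -[in k ^+ N](prednK N0) exprS mulrA mulrCA mulVf ?mulr1 //.
    by rewrite expf_neq0 // gt_eqF.
  apply: ler_pM => //.
    rewrite lef_pV2 ?posrE ?exprn_gt0 //.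
    by apply: lerXn2r => //; rewrite nnegrE ltW.
  rewrite -[X in _ ^+ X](card_ord N) -prodr_const.
  by apply: ler_prod => j _; rewrite r0 r_le.
have := P_sub_Q Kx; have := Q_le x; have := cS0 x.
rewrite ler_norml mulrDr => h1 h2 h3.
have h4 : 0 <= k * (1 + M) by rewrite mulr_ge0 ?addr_ge0 // ltW.
by apply/andP; split; lra.
Qed.

End perturbation.

(** * Choice of the constants, and passage between essential and pointwise bounds *)

Theorem theorem1p1 (R : realType) (N : nat) (N2 : (2 <= N)%N)
    (X : 'I_N -> pmetricType R)
    (mu : forall j, probability (borel (X j)) R)
    (sptK : exists2 S : set (dprod X), is_spt mu S & compact S)
    (P : dprod X -> R) (Pcoupling : is_coupling mu P) :
  forall eps : R, 0 < eps ->
  exists2 sigma : R, 0 < sigma &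
    forall rho : forall j, X j -> R,
      (forall j, marginal mu (rho j)) ->
      (forall j,
        ('N[mu j]_+oo [(fun t => proj_marginal mu j P t - (rho j t)%:E)]
          < sigma%:E)%E) ->
      exists2 P' : dprod X -> R, couplings mu rho P' &
        ('N[dprod_prob mu]_+oo [(fun x => (P x - P' x)%:E)] < eps%:E)%E.
Proof.
move=> eps eps0; have [S sptS cS] := sptK.
have [p pmarg Pp] := Pcoupling; have [cP P0 PpE] := Pp.
have cK j : compact (msupport (mu j)) by exact: (msupport_compact sptS).
have muK j := mu_msupportC sptS j.
have SK x : S x -> forall j, msupport (mu j) (x j).
  by move=> Sx j; exact: (spt_sub_msupport sptS).
have KS x : (forall j, msupport (mu j) (x j)) -> S x.
  exact: (box_msupport_spt sptS).
have [M M0 PM] : exists2 M, 0 <= M & forall x, S x -> P x <= M.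
  have /compact_bounded[M [_ MP]] : compact (P @` S).
    by apply: continuous_compact => //; exact: continuous_subspaceT.
  exists (Num.max (M + 1) 0); first by rewrite le_max lexx orbT.
  move=> x Sx; apply: le_trans (ler_norm _) _; apply: MP; last by exists x.
  by rewrite lt_max ltrDl ltr01.
pose B := 1 + M + (2 + M) ^+ N.
have B0 : 0 < B.
  by rewrite ltr_pwDl ?exprn_ge0 ?addr_ge0 // ltr_pwDl.
(* The first bound ensures [k < 1], the second makes the total error [k * B] at most [eps / 2]. *)
pose k := Num.min (1 / 2) (eps / 2 / B).
have k0 : 0 < k by rewrite lt_min !divr_gt0.
have k1 : k < 1 by rewrite gt_min; apply/orP; left; lra.
have kB : k * B <= eps / 2.
  by rewrite -ler_pdivlMr // ge_min lexx orbT.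
have cpj j : continuous (fun x : dprod X => p j (x j)).
  move=> x; apply: (@continuous_comp _ _ _ (fun x : dprod X => x j) (p j)).
    exact: continuous_dprod_proj.
  by have [+ _ _] := pmarg j; exact.
have pj0 j (x : dprod X) : 0 <= p j (x j) by have [_ + _] := pmarg j; apply.
have Ppos x : S x -> 0 < P x -> forall j, 0 < p j (x j).
  move=> Sx Px j; rewrite -lte_fin -PpE.
  exact: (coupling_pos cK muK j cP P0 (SK x Sx) Px).
have [d d0 Pd] := compact_trunc_close cS cP P0 cpj pj0 Ppos k0.
(* Closeness within [d] keeps the truncated marginals below [rho j]; closeness within [k] keeps the
   defects of order [k]. *)
exists (Num.min d k); first by rewrite lt_min d0.
move=> rho mrho rho_close.
have close j t : msupport (mu j) t -> `|p j t - rho j t| <= Num.min d k.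
  have [crho _ _] := mrho j; have [cp _ _] := pmarg j.
  apply: (msupport_ae_le (mu := mu j) (f := fun t => `|p j t - rho j t|)).
    move=> u; apply: (@continuous_comp _ _ _ (fun t => p j t - rho j t)).
      by apply: cvgB; [exact: cp|exact: crho].
    exact: norm_continuous.
  have /Lnorm_pinfty_le [A [mA A0 subA]] := ltW (rho_close j).
  exists A; split => // u nle; apply: subA => /= le_u; apply: nle.
  by move: le_u; rewrite PpE -EFinB abse_EFin lee_fin.
have N0 : (0 < N)%N by exact: leq_trans N2.
have [P' P'c P'P] := exists_close_coupling N0 cK muK pmarg Pp k0 k1 d0 M0
  (fun x Kx => PM x (KS x Kx)) (fun x Kx => Pd x (KS x Kx)) mrho close.
(* Pointwise bounds on [S] control the essential supremum only non-strictly; [eps / 2] leaves room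
   for the strict inequality. *)
exists P' => //; apply: (@le_lt_trans _ _ (eps / 2)%:E); last first.
  by rewrite lte_fin ltr_pdivrMr // ltr_pMr // ltr1n.
apply/Lnorm_pinfty_le; have [_ [A [mA A0 subA]] _] := sptS.
exists A; split => // x nle; apply: subA => /= Sx; apply: nle.
by rewrite /= lee_fin (le_trans (P'P x (SK x Sx))).
Qed.
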